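(* Let $\Lambda$ be a finite dimensional local algebra over a field. Then $k\text{-}\operatorname{ddell}\Lambda<\infty$ for every integer $k\ge1$.
   Context: Modules are right $\Lambda$-modules; $\mathrm{mod}\,\Lambda$ denotes the category of finitely generated ones. $\mathbb N$ is the set of nonnegative integers; the infimum of the empty set is $+\infty$. $\Omega M$ is the kernel of a projective cover of $M$, $\Omega^0M=M$, $\Omega^{n+1}M=\Omega(\Omega^nM)$. ''$A$ is a direct summand of $B$ up to projective summands'' means that $A$ is isomorphic to a direct summand of $B\oplus P$ for some projective $P$. For an integer $j\ge1$, $j\text{-}\operatorname{dell}M$ is the infimum of all $n\in\mathbb N$ such that $\Omega^nM$ is a direct summand of $\Omega^{n+j}N$ up to projective summands for some $N\in\mathrm{mod}\,\Lambda$. $k\text{-}\operatorname{ddell}M$ is the infimum of all $m\in\mathbb N$ for which there exist $0\le n\le m$ and an exact sequence $0\to C_n\to\cdots\to C_1\to C_0\to M\to0$ in $\mathrm{mod}\,\Lambda$ with $(i+k)\text{-}\operatorname{dell}C_i\le m-i$ for $i=0,\dots,n$. $k\text{-}\operatorname{ddell}\Lambda=\sup\{k\text{-}\operatorname{ddell}S\mid S\text{ a simple right }\Lambda\text{-module}\}$. *)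

(* Defs.v *)
From mathcomp Require Import all_boot all_order all_algebra all_field.
From mathcomp Require Import boolp.

Set Implicit Arguments.
Unset Strict Implicit.
Unset Printing Implicit Defensive.

Import GRing.Theory.
Local Open Scope ring_scope.

(* The extended natural numbers, i.e. the set N together with +oo. *)
Inductive enat := Fin of nat | Infty.

Definition ele (x y : enat) : bool :=
  match x, y with
  | _, Infty => true
  | Infty, Fin _ => false
  | Fin m, Fin n => (m <= n)%N
  end.

Definition elt (x y : enat) : bool := ~~ ele y x.

Declare Scope enat_scope.
Delimit Scope enat_scope with enat.
Bind Scope enat_scope with enat.
Notation "x <= y" := (ele x y) : enat_scope.
Notation "x < y" := (elt x y) : enat_scope.

Lemma ex_asbool (P : nat -> Prop) : (exists n, P n) -> exists n, `[< P n >].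
Proof. by case=> n Pn; exists n; apply/asboolP. Qed.

Definition einf (P : nat -> Prop) : enat :=
  match pselect (exists n, P n) with
  | left exP => Fin (ex_minn (ex_asbool exP))
  | right _ => Infty
  end.

(* The least upper bound, as the infimum of the finite upper bounds. *)
Definition esup (E : enat -> Prop) : enat :=
  einf (fun b => forall x, E x -> (x <= Fin b)%enat).

Lemma einf_leP (P : nat -> Prop) (m : nat) :
  (einf P <= Fin m)%enat <-> exists2 n, (n <= m)%N & P n.
Proof.
rewrite /einf; case: pselect => [exP | nexP] /=.
  case: ex_minnP => n /asboolP Pn minn; split=> [le_nm | [p le_pm Pp]].
    by exists n.
  by apply: leq_trans le_pm; apply: minn; apply/asboolP.
by split=> // -[n _ Pn]; case: nexP; exists n.
Qed.

Lemma einf_ltInfty (P : nat -> Prop) :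
  (einf P < Infty)%enat <-> exists n, P n.
Proof. by rewrite /einf; case: pselect => exP; split. Qed.

Lemma esup_leP (E : enat -> Prop) (y : enat) :
  (esup E <= y)%enat <-> forall x, E x -> (x <= y)%enat.
Proof.
case: y => [m|]; last by split=> [_ [] | _] //; case: (esup E).
split=> [/einf_leP[b le_bm ubE] x /ubE | ubE]; last first.
  by apply/einf_leP; exists m.
by case: x => //= n le_nb; apply: leq_trans le_bm.
Qed.

(* The module theory below is written for left modules over a ring R; right  *)
(* modules over L are left modules over the converse ring L^c.               *)
Section Modules.
Variable R : pzRingType.

Definition finitely_generated (M : lmodType R) : Prop :=
  exists (n : nat) (g : 'I_n -> M),
    forall x : M, exists c : 'I_n -> R, x = \sum_(i < n) c i *: g i.

Record fgmod : Type := FgMod {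
  fgmod_sort :> lmodType R;
  fgmodP : finitely_generated fgmod_sort
}.

Definition surj (A B : Type) (f : A -> B) : Prop := forall y, exists x, f x = y.

Definition isomorphic (M N : lmodType R) : Prop :=
  exists f : {linear M -> N}, bijective f.

Definition exact (A B C : lmodType R)
    (f : {linear A -> B}) (g : {linear B -> C}) : Prop :=
  forall y : B, g y = 0 <-> exists x : A, f x = y.

Definition projective (P : lmodType R) : Prop :=
  forall (M N : lmodType R) (g : {linear M -> N}) (f : {linear P -> N}),
    surj g -> exists h : {linear P -> M}, forall x, g (h x) = f x.

Definition superfluous (M : lmodType R) (U : {pred M}) : Prop :=
  forall X : {pred M}, submod_closed X ->
    (forall x, exists2 u, u \in U & exists2 v, v \in X & x = u + v) ->
    forall x, x \in X.

Definition projective_cover (P M : lmodType R) (p : {linear P -> M}) : Prop :=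
  [/\ projective P, surj p & superfluous [pred x | p x == 0]].

Definition simple_module (S : lmodType R) : Prop :=
  (exists x : S, x != 0) /\
  forall X : {pred S}, submod_closed X ->
    (forall x, x \in X -> x = 0) \/ (forall x, x \in X).

Definition maximal_submodule (M : lmodType R) (X : {pred M}) : Prop :=
  [/\ submod_closed X, exists x, x \notin X &
      forall Y : {pred M}, submod_closed Y -> {subset X <= Y} ->
        Y =i X \/ (forall x, x \in Y)].

(* Syzygies are only determined up to isomorphism, so they are given by a    *)
(* relation: [syzygy n M X] says that X is (isomorphic to) Omega^n M.        *)
Definition syzygy1 (M X : fgmod) : Prop :=
  exists (P : fgmod) (p : {linear P -> M}) (i : {linear X -> P}),
    [/\ projective_cover p, injective i & exact i p].

Fixpoint syzygy (n : nat) (M X : fgmod) : Prop :=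
  if n is n'.+1 then exists2 Y : fgmod, syzygy n' M Y & syzygy1 Y X
  else isomorphic M X.

Definition summand_up_to_projectives (A B : fgmod) : Prop :=
  exists P C : fgmod, projective P /\ isomorphic (A * C)%type (B * P)%type.

Definition dell (j : nat) (M : fgmod) : enat :=
  einf (fun n => exists N X Y : fgmod,
    [/\ syzygy n M X, syzygy (n + j) N Y & summand_up_to_projectives X Y]).

(* An exact sequence 0 -> C_n -> ... -> C_1 -> C_0 -> M -> 0.  The leftmost   *)
(* zero is C_(n+1), and the C_i with i > n+1 play no role.                   *)
Definition exact_resolution (n : nat) (M : fgmod) (C : nat -> fgmod)
    (d : forall i, {linear C i.+1 -> C i}) (e : {linear C 0%N -> M}) : Prop :=
  [/\ surj e, exact (d 0%N) e,
      forall i, (i < n)%N -> exact (d i.+1) (d i) &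
      forall x : C n.+1, x = 0].

Definition ddell (k : nat) (M : fgmod) : enat :=
  einf (fun m => exists2 n, (n <= m)%N &
    exists (C : nat -> fgmod) (d : forall i, {linear C i.+1 -> C i})
           (e : {linear C 0%N -> M}),
      exact_resolution n d e /\
      forall i, (i <= n)%N -> (dell (i + k) (C i) <= Fin (m - i))%enat).

End Modules.

Section Algebras.
Variables (K : fieldType) (L : falgType K).

Definition ddell_algebra (k : nat) : enat :=
  esup (fun x => exists S : fgmod L^c, simple_module S /\ x = ddell k S).

(* L has a unique maximal right ideal; (L^c)^o is L as a right L-module. *)
Definition local_algebra : Prop :=
  exists2 I : {pred (L^c)^o}, maximal_submodule (R := L^c) I &
    forall J : {pred (L^c)^o}, maximal_submodule (R := L^c) J -> J =i I.

End Algebras.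

(* Main.v *)
(* Call M k-resolvable if it has a finite resolution by finitely generated
   modules C_i with (i + k)-dell C_i finite; this is finiteness of the derived
   delooping level, because the bounds m - i only ask m to be large. Every
   module is 0-resolvable. Syzygies of k-resolvable modules are
   (k + 1)-resolvable, and k-resolvable modules are closed under extensions
   A -> B -> C: if X -> A starts a resolution of A and Q -> C is a projective
   presentation, then the kernel of X + Q -> B is again an extension, of Omega C
   by the kernel of X -> A.

   Over a local algebra L every nonzero module M has a nonzero map to L, since
   the simple top of M is the simple socle constituent of L. Its image U is a
   syzygy of L / U, hence (k + 1)-resolvable as soon as L / U is k-resolvable.
   Filtering M by such images shows, by induction on k, that all modules are
   k-resolvable for all k. *)
From HB Require Import structures.
Require Import Defs.
From mathcomp Require Import all_boot all_order all_algebra all_field.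
From mathcomp Require Import boolp zify.

Set Implicit Arguments.
Unset Strict Implicit.
Unset Printing Implicit Defensive.

Import GRing.Theory.
Local Open Scope ring_scope.

Lemma exists_min (T : Type) (S : T -> Prop) (m : T -> nat) :
  (exists x, S x) -> exists2 x, S x & forall y, S y -> (m x <= m y)%N.
Proof.
move=> [x0 Sx0]; have exP : exists n, `[< exists2 x, S x & m x = n >].
  by exists (m x0); apply/asboolP; exists x0.
case: (ex_minnP exP) => n /asboolP[x Sx <-] min_n; exists x => // y Sy.
by apply: min_n; apply/asboolP; exists y.
Qed.

(** * Linear maps, submodules and quotients *)

Section LinearMaps.
Variable R : pzRingType.
Implicit Types A B M N : lmodType R.

Definition mklin M N (f : M -> N) (lin_f : linear f) : {linear M -> N} :=
  HB.pack f (GRing.isLinear.Build R M N *:%R f lin_f).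

Lemma linear_of_rel M N (G : M -> N -> Prop) :
  (forall x, exists y, G x y) ->
  (forall x y y', G x y -> G x y' -> y = y') ->
  (forall a x y x' y', G x y -> G x' y' -> G (a *: x + x') (a *: y + y')) ->
  exists f : {linear M -> N}, forall x, G x (f x).
Proof.
move=> /choice[f Gf] G_fun G_lin.
have lin_f : linear f by move=> a x y; apply: G_fun (G_lin _ _ _ _ _ _ _).
by exists (mklin lin_f).
Qed.

Lemma linear_factor M A B (i : {linear A -> B}) (f : {linear M -> B}) :
  injective i -> (forall x, exists a, i a = f x) ->
  exists g : {linear M -> A}, forall x, i (g x) = f x.
Proof.
move=> inj_i f_i; apply: (linear_of_rel (G := fun x a => i a = f x)) => //.
  by move=> x y y' ey ey'; apply: inj_i; rewrite ey.
by move=> a x y x' y' ey ey'; rewrite !linearP ey ey'.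
Qed.

Lemma linear_pair M A B (f : {linear M -> A}) (g : {linear M -> B}) :
  exists h : {linear M -> (A * B)%type}, forall x, h x = (f x, g x).
Proof.
have lin_h : linear (fun x => (f x, g x) : A * B).
  by move=> a x y; rewrite !linearP.
by exists (mklin lin_h).
Qed.

Lemma linear_copair M A B (f : {linear A -> M}) (g : {linear B -> M}) :
  exists h : {linear (A * B)%type -> M}, forall x, h x = f x.1 + g x.2.
Proof.
have lin_h : linear (fun x : A * B => f x.1 + g x.2).
  by move=> a x y; rewrite /= !linearP scalerDr addrACA.
by exists (mklin lin_h).
Qed.

Lemma linear_fst A B :
  exists h : {linear (A * B)%type -> A}, forall x, h x = x.1.
Proof.
have lin_h : linear (fun x : A * B => x.1) by [].
by exists (mklin lin_h).
Qed.

Lemma linear_snd A B :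
  exists h : {linear (A * B)%type -> B}, forall x, h x = x.2.
Proof.
have lin_h : linear (fun x : A * B => x.2) by [].
by exists (mklin lin_h).
Qed.

Lemma exact_comp0 A B M (f : {linear A -> B}) (g : {linear B -> M}) x :
  exact f g -> g (f x) = 0.
Proof. by move=> fg; apply/fg; exists x. Qed.

Lemma ker_submod M N (f : {linear M -> N}) :
  submod_closed [pred x | f x == 0].
Proof.
split=> [|a x y]; rewrite !inE ?linear0 // => /eqP fx /eqP fy.
by rewrite linearP fx fy scaler0 addr0.
Qed.

Definition im_pred (S T : Type) (f : S -> T) : {pred T} :=
  [pred y | `[< exists x, f x = y >]].

Lemma im_predP (S T : Type) (f : S -> T) y :
  reflect (exists x, f x = y) (y \in im_pred f).
Proof. exact: asboolP. Qed.

Lemma im_submod M N (f : {linear M -> N}) : submod_closed (im_pred f).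
Proof.
split=> [|a _ _ /im_predP[x <-] /im_predP[y <-]]; apply/im_predP.
  by exists 0; rewrite linear0.
by exists (a *: x + y); rewrite linearP.
Qed.

Definition submodule_of M (X : {pred M}) of submod_closed X := {x | x \in X}.

HB.instance Definition _ M (X : {pred M}) (hX : submod_closed X) :=
  SubChoice.on (submodule_of hX).
HB.instance Definition _ M (X : {pred M}) (hX : submod_closed X) :=
  GRing.SubChoice_isSubLmodule.Build R M _ (submodule_of hX) hX.

Lemma submodule_incl M (X : {pred M}) (hX : submod_closed X) :
  exists i : {linear submodule_of hX -> M},
    injective i /\ forall y, (y \in X) <-> exists x, i x = y.
Proof.
have lin_val : linear (val : submodule_of hX -> M).
  by move=> a x y; rewrite linearP.
exists (mklin lin_val); split=> [|y]; first exact: val_inj.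
by split=> [Xy | [x <-]]; [exists (Sub y Xy) | exact: valP].
Qed.

End LinearMaps.

Section Quotient.
Variables (R : pzRingType) (M : lmodType R) (X : {pred M}).
Variable (hX : submod_closed X).

Let rep (x : M) : M := choose [pred y | x - y \in X] x.

Let subX x y : x \in X -> y \in X -> x - y \in X.
Proof. by case: hX => X0 XD Xx Xy; rewrite addrC -scaleN1r XD. Qed.

Let addX x y : x \in X -> y \in X -> x + y \in X.
Proof. by case: hX => X0 XD Xx Xy; rewrite -[x]scale1r XD. Qed.

Let rep_mod x : x - rep x \in X.
Proof.
by apply: (@chooseP _ [pred y | x - y \in X] x); rewrite inE subrr; case: hX.
Qed.

Let rep_eq x y : x - y \in X -> rep x = rep y.
Proof.
move=> Xxy; rewrite /rep.
rewrite (@eq_choose _ [pred z | x - z \in X] [pred z | y - z \in X]).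
  apply: choose_id; rewrite !inE ?subrr; last by case: hX.
  by rewrite -opprB -[- _]add0r subX //; case: hX.
move=> z /=; apply/idP/idP => Xz.
  by rewrite -[y](subKr x) addrAC subX.
by rewrite -[x](subrK y) -addrA addX.
Qed.

Let rep_id x : rep (rep x) = rep x.
Proof. by apply/esym/rep_eq/rep_mod. Qed.

Definition quotient_module of submod_closed X := {x : M | rep x == x}.
HB.instance Definition _ := SubChoice.on (quotient_module hX).

Let pi (x : M) : quotient_module hX := exist _ (rep x) (introT eqP (rep_id x)).

Let val_piE x : val (pi x) = rep x. Proof. by []. Qed.

Let pi_val (u : quotient_module hX) : pi (val u) = u.
Proof. by apply: val_inj; rewrite val_piE; case: u => x /= /eqP. Qed.

Let val_pi x : x - val (pi x) \in X.
Proof. by rewrite val_piE. Qed.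

Let pi_eq x y : x - y \in X -> pi x = pi y.
Proof. by move=> Xxy; apply: val_inj; rewrite !val_piE; apply: rep_eq. Qed.

Let pi_eqP x y : pi x = pi y -> x - y \in X.
Proof.
move=> exy; rewrite -[x](subrK (val (pi x))) -addrA addX ?val_pi // exy.
by rewrite -opprB -[- _]add0r subX ?val_pi //; case: hX.
Qed.

Let zero : quotient_module hX := pi 0.
Let opp (u : quotient_module hX) : quotient_module hX := pi (- val u).
Let add (u v : quotient_module hX) : quotient_module hX := pi (val u + val v).
Let scale a (u : quotient_module hX) : quotient_module hX := pi (a *: val u).

Let piD x y : pi (x + y) = add (pi x) (pi y).
Proof. by apply: pi_eq; rewrite opprD addrACA addX ?val_pi. Qed.

Let piZ a x : pi (a *: x) = scale a (pi x).
Proof.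
apply: pi_eq; rewrite -scalerBr -[_ *: _]addr0.
by case: hX => X0 XD; rewrite XD ?val_pi.
Qed.

Let piN x : pi (- x) = opp (pi x).
Proof. by have := piZ (-1) x; rewrite /scale /opp !scaleN1r. Qed.

Let addA : associative add.
Proof.
by move=> u v w; rewrite -(pi_val u) -(pi_val v) -(pi_val w) -!piD addrA.
Qed.
Let addC : commutative add.
Proof. by move=> u v; rewrite -(pi_val u) -(pi_val v) -!piD addrC. Qed.
Let add0 : left_id zero add.
Proof. by move=> u; rewrite -(pi_val u) -piD add0r. Qed.
Let addN : left_inverse zero opp add.
Proof. by move=> u; rewrite -(pi_val u) -piN -piD addNr. Qed.

HB.instance Definition _ :=
  GRing.isZmodule.Build (quotient_module hX) addA addC add0 addN.

Let scaleA a b u : scale a (scale b u) = scale (a * b) u.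
Proof. by rewrite -(pi_val u) -!piZ scalerA. Qed.
Let scale1 : left_id 1 scale.
Proof. by move=> u; rewrite -(pi_val u) -piZ scale1r. Qed.
Let scaleDr : right_distributive scale +%R.
Proof.
move=> a u v; rewrite -(pi_val u) -(pi_val v).
by rewrite -[_ + _]piD -!piZ -[RHS]piD scalerDr.
Qed.
Let scaleDl u : {morph scale^~ u : a b / a + b}.
Proof. by move=> a b /=; rewrite -(pi_val u) -!piZ -[RHS]piD scalerDl. Qed.

HB.instance Definition _ :=
  GRing.Zmodule_isLmodule.Build R (quotient_module hX)
    scaleA scale1 scaleDr scaleDl.

Lemma quotient_proj :
  exists p : {linear M -> quotient_module hX},
    surj p /\ forall x, p x = 0 <-> x \in X.
Proof.
have lin_pi : linear pi by move=> a x y; rewrite piD piZ.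
exists (mklin lin_pi); split=> [u|x /=]; first by exists (val u); apply: pi_val.
split=> [/pi_eqP | Xx]; first by rewrite subr0.
by apply: pi_eq; rewrite subr0.
Qed.

End Quotient.

(** * Finitely generated and projective modules *)

Section FgModules.
Variable R : pzRingType.

Lemma finitely_generatedP (M : lmodType R) :
  finitely_generated M <->
  exists (n : nat) (p : {linear 'rV[R]_n -> M}), surj p.
Proof.
split=> [[n [g gen_g]] | [n [p surj_p]]].
  have lin_p : linear (fun v : 'rV[R]_n => \sum_i v 0 i *: g i).
    move=> a u v; rewrite scaler_sumr -big_split /=; apply: eq_bigr => i _.
    by rewrite !mxE scalerDl scalerA.
  exists n, (mklin lin_p) => y; have [c ->] := gen_g y.
  by exists (\row_i c i); apply: eq_bigr => i _; rewrite mxE.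
exists n, (fun i => p (delta_mx 0 i)) => x; have [v <-] := surj_p x.
exists (v 0); rewrite {1}(row_sum_delta v) linear_sum.
by apply: eq_bigr => i _; rewrite linearZ.
Qed.

Lemma fg_image (M N : lmodType R) (f : {linear M -> N}) :
  surj f -> finitely_generated M -> finitely_generated N.
Proof.
move=> surj_f [n [g gen_g]]; exists n, (fun i => f (g i)) => y.
have [x <-] := surj_f y; have [c ->] := gen_g x.
by exists c; rewrite linear_sum; apply: eq_bigr => i _; rewrite linearZ.
Qed.

Lemma fg_row n : finitely_generated 'rV[R]_n.
Proof. by apply/finitely_generatedP; exists n, idfun => x; exists x. Qed.

Lemma fg_prod (M N : fgmod R) : finitely_generated (M * N)%type.
Proof.
have [n [g gen_g]] := fgmodP M; have [m [h gen_h]] := fgmodP N.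
exists (n + m)%N, (fun i => match split i with
  inl j => (g j, 0) | inr j => (0, h j) end) => -[x y].
have [c ->] := gen_g x; have [c' ->] := gen_h y.
exists (fun i => match split i with inl j => c j | inr j => c' j end).
have sumE I (r : seq I) (F : I -> (M * N)%type) :
    \sum_(i <- r) F i = (\sum_(i <- r) (F i).1, \sum_(i <- r) (F i).2).
  by elim/big_rec3: _ => // i u v w _ ->.
rewrite big_split_ord /= !sumE /=; congr (_, _).
  rewrite [X in _ + X]big1 ?addr0 => [|i _]; last first.
    by rewrite (unsplitK (inr i)) /= scaler0.
  by apply: eq_bigr => i _; rewrite (unsplitK (inl i)).
rewrite [X in X + _]big1 ?add0r => [|i _]; last first.
  by rewrite (unsplitK (inl i)) /= scaler0.
by apply: eq_bigr => i _; rewrite (unsplitK (inr i)).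
Qed.

Definition free_fgmod n : fgmod R := FgMod (fg_row n).
Definition prod_fgmod (M N : fgmod R) : fgmod R := FgMod (fg_prod M N).

Lemma free_fgmod0 (x : free_fgmod 0) : x = 0.
Proof. exact: thinmx0. Qed.

Lemma projective_free n : projective 'rV[R]_n.
Proof.
move=> M N g f surj_g.
have [s gs] := choice (fun i : 'I_n => surj_g (f (delta_mx 0 i))).
have lin_h : linear (fun v : 'rV[R]_n => \sum_i v 0 i *: s i).
  move=> a u v; rewrite scaler_sumr -big_split /=; apply: eq_bigr => i _.
  by rewrite !mxE scalerDl scalerA.
exists (mklin lin_h) => v; rewrite /= [in RHS](row_sum_delta v) !linear_sum.
by apply: eq_bigr => i _; rewrite !linearZ /= gs.
Qed.

Lemma projective_retract (P Q : lmodType R)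
    (i : {linear P -> Q}) (r : {linear Q -> P}) :
  (forall x, r (i x) = x) -> projective Q -> projective P.
Proof.
move=> ri proj_Q M N g f surj_g.
have [h gh] := proj_Q M N g (f \o r) surj_g.
by exists (h \o i) => x /=; rewrite gh /= ri.
Qed.

Lemma projective_prod (P Q : lmodType R) :
  projective P -> projective Q -> projective (P * Q)%type.
Proof.
move=> proj_P proj_Q M N g f surj_g.
have [iP iPE] := linear_pair (idfun : {linear P -> P}) (\0 : {linear P -> Q}).
have [iQ iQE] := linear_pair (\0 : {linear Q -> P}) (idfun : {linear Q -> Q}).
have [h gh] := proj_P M N g (f \o iP) surj_g.
have [h' gh'] := proj_Q M N g (f \o iQ) surj_g.
have [k kE] := linear_copair h h'.
exists k => -[x y]; rewrite kE linearD gh gh' /= iPE iQE -linearD.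
by congr (f (_, _)); rewrite /= ?addr0 ?add0r.
Qed.

Lemma free_cover (M : fgmod R) :
  exists n (p : {linear free_fgmod n -> M}), surj p.
Proof. exact/finitely_generatedP/fgmodP. Qed.

Lemma quotient_exists (M : fgmod R) (X : {pred M}) : submod_closed X ->
  exists (N : fgmod R) (p : {linear M -> N}),
    surj p /\ forall x, p x = 0 <-> x \in X.
Proof.
move=> hX; have [p [surj_p pX]] := quotient_proj hX.
by exists (FgMod (fg_image surj_p (fgmodP M))), p.
Qed.

Lemma isomorphic_sym (M N : lmodType R) : isomorphic M N -> isomorphic N M.
Proof.
case=> f [g fK gK].
by exists (mklin (can2_linear fK gK)); exists f.
Qed.

Lemma isomorphicW (M N : lmodType R) (f : {linear M -> N}) :
  injective f -> surj f -> isomorphic M N.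
Proof.
move=> inj_f surj_f; have [g gE] := choice surj_f.
by exists f; exists g => // x; apply: inj_f.
Qed.

End FgModules.

(** * Stable retracts and syzygies from arbitrary projective presentations *)

Section Stable.
Variable R : pzRingType.
Implicit Types A B C I K M N P Q W X Y Z : fgmod R.

Definition short_exact K X M
    (i : {linear K -> X}) (e : {linear X -> M}) : Prop :=
  [/\ injective i, exact i e & surj e].

(* The identity of A factors through B in the stable category. *)
Definition stable_retract A B : Prop :=
  exists (P : fgmod R) (f : {linear A -> B}) (g : {linear B -> A})
    (u : {linear A -> P}) (v : {linear P -> A}),
    projective P /\ forall x, g (f x) + v (u x) = x.

Lemma stable_retract_retract A B (f : {linear A -> B}) (g : {linear B -> A}) :
  (forall x, g (f x) = x) -> stable_retract A B.
Proof.
move=> fK; exists (free_fgmod R 0), f, g, \0, \0; split=> [|x].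
  exact: projective_free.
by rewrite fK addr0.
Qed.

Lemma stable_retract_iso A B : isomorphic A B -> stable_retract A B.
Proof.
move=> isoAB; have [f [g fK gK]] := isoAB.
exact: (@stable_retract_retract A B f (mklin (can2_linear fK gK))).
Qed.

Lemma stable_retract_trans B A C :
  stable_retract A B -> stable_retract B C -> stable_retract A C.
Proof.
move=> [P [f [g [u [v [projP fg]]]]]] [Q [f' [g' [u' [v' [projQ fg']]]]]].
have [w wE] := linear_pair (u' \o f) u.
have [w' w'E] := linear_copair (g \o v') v.
exists (prod_fgmod Q P), (f' \o f), (g \o g'), w, w'; split=> [|x].
  exact: projective_prod.
by rewrite w'E wE /= addrA -linearD fg' fg.
Qed.

Lemma stable_retract_projective P A : projective P -> stable_retract P A.
Proof.
move=> projP; exists P, \0, \0, idfun, idfun; split=> // x.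
by rewrite /= add0r.
Qed.

Lemma stable_retract_prod A P :
  projective P -> stable_retract (prod_fgmod A P) A.
Proof.
move=> projP.
have [f fE] := linear_fst A P; have [u uE] := linear_snd A P.
have [g gE] := linear_pair (idfun : {linear A -> A}) (\0 : {linear A -> P}).
have [v vE] := linear_pair (\0 : {linear P -> A}) (idfun : {linear P -> P}).
exists P, f, g, u, v; split=> // -[x y]; rewrite fE gE uE vE.
by congr (_, _); rewrite /= ?addr0 ?add0r.
Qed.

Definition presyzygy1 M X : Prop :=
  exists (P : fgmod R) (p : {linear P -> M}) (i : {linear X -> P}),
    projective P /\ short_exact i p.

Fixpoint presyzygy n M X : Prop :=
  if n is n'.+1 then exists2 Y, presyzygy n' M Y & presyzygy1 Y X
  else isomorphic M X.

Lemma isomorphic_refl (M : lmodType R) : isomorphic M M.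
Proof. by exists idfun; exists idfun. Qed.

Lemma syzygy_presyzygy n M X : syzygy n M X -> presyzygy n M X.
Proof.
elim: n X => //= n IHn X [Y /IHn MY [P [p [i [[projP surj_p _] inj_i ex_ip]]]]].
by exists Y => //; exists P, p, i.
Qed.

Lemma presyzygy1_isor M X Y :
  presyzygy1 M X -> isomorphic X Y -> presyzygy1 M Y.
Proof.
move=> [P [p [i [projP [inj_i ex_ip surj_p]]]]] /isomorphic_sym[f [g fK gK]].
exists P, p, (i \o f); split=> //; split=> //.
  exact: inj_comp inj_i (can_inj fK).
move=> y; rewrite ex_ip; split=> -[x <-]; first by exists (g x); rewrite /= gK.
by exists (f x).
Qed.

Lemma presyzygyS_front n C Z W :
  presyzygy1 C Z -> presyzygy n Z W -> presyzygy n.+1 C W.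
Proof.
move=> CZ; elim: n W => [W ZW | n IHn W [Y /IHn CY YW]]; last by exists Y.
by exists C; [exact: isomorphic_refl | exact: presyzygy1_isor ZW].
Qed.

(* Lift f and g between the projective presentations; the endomorphism
   1 - g f - v u of the presentation of A then lands in the syzygy of A, so on
   that syzygy 1 - g f factors through a projective. *)
Lemma stable_retract_presyzygy1 A B X Y :
  stable_retract A B -> presyzygy1 A X -> presyzygy1 B Y -> stable_retract X Y.
Proof.
move=> [Q [f [g [u [v [projQ fg]]]]]].
move=> [P [p [i [projP [inj_i ex_ip surj_p]]]]].
move=> [P' [p' [i' [projP' [inj_i' ex_ip' surj_p']]]]].
have [f1 f1E] := projP _ _ p' (f \o p) surj_p'.
have [g1 g1E] := projP' _ _ p (g \o p') surj_p.
have [v1 v1E] := projQ _ _ p v surj_p.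
have [F FE] : exists F : {linear X -> Y}, forall x, i' (F x) = f1 (i x).
  apply: (linear_factor (f := f1 \o i)) inj_i' _ => x /=.
  by apply/ex_ip'; rewrite f1E /= (exact_comp0 _ ex_ip) linear0.
have [G GE] : exists G : {linear Y -> X}, forall y, i (G y) = g1 (i' y).
  apply: (linear_factor (f := g1 \o i')) inj_i _ => y /=.
  by apply/ex_ip; rewrite g1E /= (exact_comp0 _ ex_ip') linear0.
have [H HE] : exists H : {linear P -> X},
    forall z, i (H z) = z - g1 (f1 z) - v1 (u (p z)).
  pose h : {linear P -> P} := (idfun \- (g1 \o f1)) \- (v1 \o (u \o p)).
  apply: (linear_factor (f := h)) inj_i _ => z; apply/ex_ip.
  by rewrite /= !linearB /= g1E /= f1E v1E /= -addrA -opprD fg subrr.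
exists P, F, G, i, H; split=> // x; apply: inj_i.
by rewrite linearD GE FE HE (exact_comp0 _ ex_ip) !linear0 addr0 addrC subrK.
Qed.

Lemma stable_retract_presyzygy n A B X Y : stable_retract A B ->
  presyzygy n A X -> presyzygy n B Y -> stable_retract X Y.
Proof.
move=> AB; elim: n X Y => [|n IHn] X Y /=.
  move=> AX BY; apply: stable_retract_trans (stable_retract_iso BY).
  by apply: stable_retract_trans AB; apply/stable_retract_iso/isomorphic_sym.
move=> [X' AX' X'X] [Y' BY' Y'Y].
exact: stable_retract_presyzygy1 (IHn _ _ AX' BY') X'X Y'Y.
Qed.

Definition fin_dell j M : Prop :=
  exists n N X Y,
    [/\ presyzygy n M X, presyzygy (n + j) N Y & stable_retract X Y].

Definition noetherian : Prop :=
  forall M (X : {pred M}) (hX : submod_closed X),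
    finitely_generated (submodule_of hX).

Variable noethR : noetherian.

Lemma submodule_exists M (X : {pred M}) : submod_closed X ->
  exists K (i : {linear K -> M}),
    injective i /\ forall y, (y \in X) <-> exists x, i x = y.
Proof.
move=> hX; have [i iP] := submodule_incl hX.
by exists (FgMod (noethR hX)), i.
Qed.

Lemma kernel_exists M N (f : {linear M -> N}) :
  exists K (i : {linear K -> M}), injective i /\ exact i f.
Proof.
have [K [i [inj_i iE]]] := submodule_exists (ker_submod f).
by exists K, i; split=> // y; rewrite -iE inE; split=> /eqP.
Qed.

Lemma presyzygy1_exists M : exists X, presyzygy1 M X.
Proof.
have [n [p surj_p]] := free_cover M.
have [X [i [inj_i ex_i]]] := kernel_exists p.
by exists X, (free_fgmod R n), p, i; split=> //; apply: projective_free.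
Qed.

Lemma presyzygy_exists n M : exists X, presyzygy n M X.
Proof.
elim: n => [|n [X MX]]; first by exists M; apply: isomorphic_refl.
by have [Y XY] := presyzygy1_exists X; exists Y, X.
Qed.

Lemma fin_dell0 M : fin_dell 0 M.
Proof.
exists 0%N, M, M, M; split; try exact: isomorphic_refl.
exact/stable_retract_iso/isomorphic_refl.
Qed.

Lemma fin_dell_projective j P : projective P -> fin_dell j P.
Proof.
move=> projP; have [Y PY] := presyzygy_exists j P.
exists 0%N, P, P, Y; split=> //; first exact: isomorphic_refl.
exact: stable_retract_projective.
Qed.

Lemma fin_dell_stable j A B :
  stable_retract A B -> fin_dell j B -> fin_dell j A.
Proof.
move=> AB [n [N [X [Y [BX NY XY]]]]]; have [X' AX'] := presyzygy_exists n A.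
exists n, N, X', Y; split=> //.
exact: stable_retract_trans (stable_retract_presyzygy AB AX' BX) XY.
Qed.

Lemma fin_dell_presyzygy1 j C Z :
  presyzygy1 C Z -> fin_dell j C -> fin_dell j.+1 Z.
Proof.
move=> CZ [n [N [X [Y [CX NY XY]]]]].
have [X' XX'] := presyzygy1_exists X; have [Y' YY'] := presyzygy1_exists Y.
have [W ZW] := presyzygy_exists n Z.
exists n, N, W, Y'; split=> //; first by rewrite addnS; exists Y.
apply: stable_retract_trans (stable_retract_presyzygy1 XY XX' YY').
apply: (@stable_retract_presyzygy n.+1 C C); last by exists X.
  exact/stable_retract_iso/isomorphic_refl.
exact: presyzygyS_front ZW.
Qed.

Lemma horseshoe A B C K X Z Q (i : {linear A -> B}) (e : {linear B -> C})
    (i0 : {linear K -> X}) (p0 : {linear X -> A})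
    (z : {linear Z -> Q}) (p : {linear Q -> C}) :
  projective Q -> short_exact i e -> short_exact i0 p0 -> short_exact z p ->
  exists W (m : {linear W -> prod_fgmod X Q}) (s : {linear prod_fgmod X Q -> B})
    (j : {linear K -> W}) (t : {linear W -> Z}),
    short_exact m s /\ short_exact j t.
Proof.
move=> projQ [inj_i ex_ie surj_e] [inj_i0 ex_0 surj_p0] [inj_z ex_zp surj_p].
have [l lE] := projQ _ _ e p surj_e.
have [s sE] : exists s : {linear prod_fgmod X Q -> B},
    forall x, s x = i (p0 x.1) + l x.2 by exact: linear_copair (i \o p0) l.
have [W [m [inj_m ex_ms]]] := kernel_exists s.
have [snd' sndE] := linear_snd X Q.
have [t tE] : exists t : {linear W -> Z}, forall y, z (t y) = (m y).2.
  have [t tE] : exists t : {linear W -> Z}, forall y, z (t y) = (snd' \o m) y.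
    apply: linear_factor inj_z _ => y /=; apply/ex_zp; rewrite sndE -lE.
    have := exact_comp0 y ex_ms; rewrite sE /= => /(congr1 e).
    by rewrite linearD (exact_comp0 _ ex_ie) add0r linear0.
  by exists t => y; rewrite tE /= sndE.
have [in1 in1E] := linear_pair (idfun : {linear X -> X}) (\0 : {linear X -> Q}).
have [j jE] : exists j : {linear K -> W}, forall x, m (j x) = (i0 x, 0).
  have [j jE] : exists j : {linear K -> W}, forall x, m (j x) = (in1 \o i0) x.
    apply: linear_factor inj_m _ => x; apply/ex_ms.
    by rewrite /= in1E sE /= (exact_comp0 _ ex_0) !linear0 addr0.
  by exists j => x; rewrite jE /= in1E.
exists W, m, s, j, t; split; split=> //.
- move=> b; have [q pq] := surj_p (e b).
  have [a ia] : exists a, i a = b - l q.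
    by apply/ex_ie; rewrite linearB lE pq subrr.
  by have [x p0x] := surj_p0 a; exists (x, q); rewrite sE /= p0x ia subrK.
- apply: raddf_inj => x jx0; apply: inj_i0; rewrite linear0.
  by have := jE x; rewrite jx0 linear0 => -[].
- move=> y; split=> [ty0 | [x <-]]; last first.
    by apply: inj_z; rewrite tE jE linear0.
  have m2 : (m y).2 = 0 by rewrite -tE ty0 linear0.
  have [x i0x] : exists x, i0 x = (m y).1.
    apply/ex_0; apply: inj_i; rewrite linear0.
    by have := exact_comp0 y ex_ms; rewrite sE /= m2 linear0 addr0.
  by exists x; apply: inj_m; rewrite jE i0x -m2; case: (m y).
- move=> zz; have [a ia] : exists a, i a = l (z zz).
    by apply/ex_ie; rewrite lE (exact_comp0 _ ex_zp).
  have [x p0x] := surj_p0 a.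
  have [y my] : exists y, m y = (- x, z zz).
    by apply/ex_ms; rewrite sE /= !linearN p0x /= ia addNr.
  by exists y; apply: inj_z; rewrite tE my.
Qed.

Fixpoint resolvable a k M : Prop :=
  if a is a'.+1 then
    exists K X (i : {linear K -> X}) (e : {linear X -> M}),
      [/\ short_exact i e, fin_dell k X & resolvable a' k.+1 K]
  else fin_dell k M.

Lemma resolvable_presyzygy1 a k C Z :
  presyzygy1 C Z -> resolvable a k C -> resolvable a k.+1 Z.
Proof.
elim: a k C Z => [|a IHa] k C Z CZ; first exact: fin_dell_presyzygy1.
move=> [K [X [i [e [ses_ie dX resK]]]]].
have [P [p [z [projP ses_zp]]]] := CZ.
have [OK KOK] := presyzygy1_exists K; have [PK [q [w [projPK ses_wq]]]] := KOK.
have [W [m [s [j [t [ses_ms ses_jt]]]]]] :=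
  horseshoe projP ses_ie ses_wq ses_zp.
exists OK, W, j, t; split=> //; last exact: IHa KOK resK.
apply: fin_dell_presyzygy1 dX; exists (prod_fgmod PK P), s, m.
by split=> //; apply: projective_prod.
Qed.

(* Induction on the length of the resolution of A only: the kernel of
   X + Q -> B is an extension of a syzygy of C by a module with a shorter
   resolution than A. *)
Lemma resolvable_extension a c k A B C
    (i : {linear A -> B}) (e : {linear B -> C}) :
  short_exact i e -> resolvable a k A -> resolvable c k C ->
  exists b, resolvable b k B.
Proof.
elim: a c k A B C i e => [|a IHa] c k A B C i e ses_ie.
  move=> dA resC; have [Z CZ] := presyzygy1_exists C.
  have [Q [p [z [projQ ses_zp]]]] := CZ.
  have ses0 : short_exact (\0 : {linear free_fgmod R 0 -> A})
      (idfun : {linear A -> A}).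
    split=> [x y _||x]; last by exists x.
      by rewrite (free_fgmod0 x) (free_fgmod0 y).
    by move=> y; split=> [y0 | [x <-]] //; exists 0; apply: esym y0.
  have [W [m [s [j [t [ses_ms [_ ex_jt surj_t]]]]]]] :=
    horseshoe projQ ses_ie ses0 ses_zp.
  exists c.+1, W, (prod_fgmod A Q), m, s; split=> //.
    exact: fin_dell_stable (stable_retract_prod _ projQ) dA.
  apply: resolvable_presyzygy1 resC; apply: presyzygy1_isor CZ _.
  apply/isomorphic_sym/(isomorphicW (f := t)) => //.
  apply: raddf_inj => y /ex_jt[x <-].
  by rewrite (free_fgmod0 x) linear0.
move=> [K [X [i0 [p0 [ses0 dX resK]]]]] resC.
have [Z CZ] := presyzygy1_exists C; have [Q [p [z [projQ ses_zp]]]] := CZ.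
have [W [m [s [j [t [ses_ms ses_jt]]]]]] :=
  horseshoe projQ ses_ie ses0 ses_zp.
have [b resW] := IHa _ _ _ _ _ _ _ ses_jt resK (resolvable_presyzygy1 CZ resC).
exists b.+1, W, (prod_fgmod X Q), m, s; split=> //.
exact: fin_dell_stable (stable_retract_prod _ projQ) dX.
Qed.

Definition rank_function M (mu : {pred M} -> nat) : Prop :=
  forall U V : {pred M}, submod_closed U -> submod_closed V ->
    {subset U <= V} ->
    (mu U <= mu V)%N /\ ((mu V <= mu U)%N -> {subset V <= U}).

Definition finite_length : Prop :=
  forall M, exists mu : {pred M} -> nat, rank_function mu.

Variable lenR : finite_length.

(* Submodules of R are syzygies, so they gain one level over their cokernels;
   a nonzero map to R splits off such a submodule as a quotient. *)
Lemma all_resolvable :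
  (forall M, (exists x : M, x != 0) ->
     exists (f : {linear M -> free_fgmod R 1}) (x : M), f x != 0) ->
  forall k M, exists a, resolvable a k M.
Proof.
move=> hom_exists; elim=> [|k IHk] M; first by exists 0%N; apply: fin_dell0.
have [mu mu_rank] := lenR M.
suffices H n N (i : {linear N -> M}) : injective i ->
    (mu (im_pred i) < n)%N -> exists a, resolvable a k.+1 N.
  by apply: (H _ M idfun _ (leqnn _)) => x y.
elim: n N i => // n IHn N i inj_i; rewrite ltnS => mu_n.
have [/hom_exists[f [x0 fx0]] | N0] :=
  pselect (exists x : N, x != 0); last first.
  exists 0%N; apply: fin_dell_projective.
  have Z0 : cancel (\0 : {linear N -> free_fgmod R 0})
      (\0 : {linear free_fgmod R 0 -> N}).
    move=> x /=; apply/eqP; rewrite eq_sym; apply/negPn/negP => xn0.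
    by case: N0; exists x.
  by apply: projective_retract Z0 _; apply: projective_free.
have [K [kap [inj_kap ex_kf]]] := kernel_exists f.
have [I [iota [inj_iota iotaE]]] := submodule_exists (im_submod f).
have [g gE] : exists g : {linear N -> I}, forall x, iota (g x) = f x.
  by apply: linear_factor => // x; apply/iotaE/im_predP; exists x.
have [C [p [surj_p pE]]] := quotient_exists (im_submod f).
have [c resC] := IHk C.
have CI : presyzygy1 C I.
  exists (free_fgmod R 1), p, iota; split; first exact: projective_free.
  by split=> // y; rewrite pE iotaE.
have ses_kg : short_exact kap g.
  split=> // [y | y].
    rewrite -ex_kf -gE; split=> [-> | gy0]; first by rewrite linear0.
    by apply: inj_iota; rewrite linear0.
  have [x fx] : exists x, f x = iota y by apply/im_predP/iotaE; exists y.
  by exists x; apply: inj_iota; rewrite gE.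
have [a resK] : exists a, resolvable a k.+1 K.
  apply: (IHn K (i \o kap)); first exact: inj_comp.
  apply: leq_trans mu_n; rewrite ltnNge; apply/negP => le_mu.
  have sub_im : {subset im_pred (i \o kap) <= im_pred i}.
    by move=> _ /im_predP[x <-]; apply/im_predP; exists (kap x).
  have [_ /(_ le_mu) sub_im'] := mu_rank _ _ (im_submod _) (im_submod _) sub_im.
  have /sub_im'/im_predP[x /= /inj_i kx] : i x0 \in im_pred i.
    by apply/im_predP; exists x0.
  by case/eqP: fx0; apply/ex_kf; exists x.
exact: resolvable_extension ses_kg resK (resolvable_presyzygy1 CI resC).
Qed.

(* Among the endomorphisms e of a free cover p with p e = p, take one
   minimizing the length of im e plus the colength of ker e: then
   F = im e + ker e, because e^2 competes with e, and im e is the projective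
   cover. *)
Lemma projective_cover_exists M :
  exists P (p : {linear P -> M}), projective_cover p.
Proof.
have [n [p surj_p]] := free_cover M; set F := free_fgmod R n in p surj_p.
have [mu mu_rank] := lenR F.
pose m (e : {linear F -> F}) :=
  (mu (im_pred e) + (mu predT - mu [pred x | e x == 0%R]))%N.
have [e pe min_e] : exists2 e : {linear F -> F}, (forall x, p (e x) = p x) &
    forall e' : {linear F -> F}, (forall x, p (e' x) = p x) -> (m e <= m e')%N.
  by apply: exists_min; exists idfun.
have min_comp (h : {linear F -> F}) : (forall x, p (h x) = p x) ->
    {subset im_pred (h \o e) <= im_pred e} ->
    {subset im_pred e <= im_pred (h \o e)} /\
    (forall x, h (e x) = 0 -> e x = 0).
  move=> ph sub_im.
  have sub_ker : {subset [pred x | e x == 0] <= [pred x | (h \o e) x == 0]}.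
    by move=> x; rewrite !inE => /eqP ex0; rewrite /= ex0 linear0.
  have sub_T : {subset [pred x | (h \o e) x == 0] <= @predT F} by [].
  have closedT : submod_closed (@predT F) by [].
  have [le1 eq1] := mu_rank _ _ (im_submod _) (im_submod _) sub_im.
  have [le2 eq2] := mu_rank _ _ (ker_submod _) (ker_submod _) sub_ker.
  have [le3 _] := mu_rank _ _ (ker_submod _) closedT sub_T.
  have le4 : (m e <= m (h \o e))%N by apply: min_e => x /=; rewrite ph pe.
  have squeeze a b c d t : (b <= a -> c <= d -> d <= t ->
      a + (t - c) <= b + (t - d) -> (a <= b) && (d <= c))%N by lia.
  have /andP[/eq1 sub_im' /eq2 sub_ker'] := squeeze _ _ _ _ _ le1 le2 le3 le4.
  by split=> // x hex; apply/eqP/(sub_ker' x); rewrite inE /= hex.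
have [im_ee ker_ee] : {subset im_pred e <= im_pred (e \o e)} /\
    forall x, e (e x) = 0 -> e x = 0.
  apply: min_comp => // _ /im_predP[x <-]; apply/im_predP.
  by exists (e x).
have [P [iota [inj_iota iotaE]]] := submodule_exists (im_submod e).
have [r rE] : exists r : {linear F -> P}, forall x, iota (r x) = e x.
  by apply: linear_factor => // x; apply/iotaE/im_predP; exists x.
have [s sE] : exists s : {linear P -> F},
    forall x, s x \in im_pred e /\ r (s x) = x.
  apply: (linear_of_rel (G := fun x y => y \in im_pred e /\ r y = x)).
  - move=> x; have /im_ee/im_predP[y /= eey] : iota x \in im_pred e.
      by apply/iotaE; exists x.
    exists (e y); split; first by apply/im_predP; exists y.
    by apply: inj_iota; rewrite rE.
  - move=> x y y' [/im_predP[z <-] rz] [/im_predP[z' <-] rz'].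
    apply/eqP; rewrite -subr_eq0 -linearB; apply/eqP/ker_ee.
    by rewrite -rE !linearB /= rz rz' subrr.
  - move=> a x y x' y' [ey ry] [ey' ry']; split; last by rewrite linearP ry ry'.
    by case: (im_submod e) => _; apply.
exists P, (p \o iota); split.
- have rs x : r (s x) = x by have [] := sE x.
  exact (projective_retract rs (@projective_free R n)).
- move=> y; have [x px] := surj_p y; exists (r x).
  by rewrite /= rE pe.
move=> X hX coverX x.
have [N [kap [inj_kap kapE]]] := submodule_exists hX.
have surj_pk : surj ((p \o iota) \o kap).
  move=> y; have [z pz] := surj_p y; have [u] := coverX (r z).
  rewrite inE => /eqP /= pu0 [v /kapE[w kw] rz]; exists w.
  by rewrite /= kw -[RHS]pz -pe -rE rz !linearD /= pu0 add0r.
have [h0 h0E] := @projective_free R n _ _ ((p \o iota) \o kap) p surj_pk.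
pose h : {linear F -> F} := iota \o (kap \o h0).
have im_h y : h y \in im_pred e by apply/iotaE; exists (kap (h0 y)).
have [||/(_ (iota x)) im_he _] := min_comp h.
- exact: h0E.
- by move=> _ /im_predP[y <-]; apply: im_h.
have /im_predP[y /= /inj_iota <-] : iota x \in im_pred (h \o e).
  by apply: im_he; apply/iotaE; exists x.
by apply/kapE; exists (h0 (e y)).
Qed.

Lemma syzygy_exists n M : exists X, syzygy n M X.
Proof.
elim: n => [|n [X MX]]; first by exists M; apply: isomorphic_refl.
have [P [p cover_p]] := projective_cover_exists X.
have [K [i [inj_i ex_ip]]] := kernel_exists p.
by exists K, X => //; exists P, p, i.
Qed.

Lemma stable_retract_summand A B :
  stable_retract A B -> summand_up_to_projectives A B.
Proof.
move=> [P [f [g [u [v [projP fg]]]]]].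
have [i iE] := linear_pair f u; have [r rE] := linear_copair g v.
have ri x : r (i x) = x by rewrite rE iE /= fg.
have [C [kap [inj_kap ex_kr]]] :=
  kernel_exists (r : {linear prod_fgmod B P -> A}).
exists P, C; split=> //; have [h hE] := linear_copair i kap.
apply: (isomorphicW (f := h)).
  apply: raddf_inj => -[a c] h0.
  have {}h0 : i a + kap c = 0 := etrans (esym (hE (a, c))) h0.
  have a0 : a = 0.
    have := congr1 r h0.
    by rewrite linearD ri (exact_comp0 _ ex_kr) addr0 linear0.
  move: h0; rewrite a0 linear0 add0r => kc0.
  by congr (_, _); apply: inj_kap; rewrite linear0.
move=> y; have [c kc] : exists c, kap c = y - i (r y).
  by apply/ex_kr; rewrite linearB ri subrr.
by exists (r y, c); rewrite hE /= kc addrC subrK.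
Qed.

Lemma dell_finite j M : fin_dell j M -> exists b, (dell j M <= Fin b)%enat.
Proof.
move=> [n [N [X [Y [MX NY XY]]]]].
have [X0 MX0] := syzygy_exists n M; have [Y0 NY0] := syzygy_exists (n + j) N.
exists n; apply/einf_leP; exists n => //; exists N, X0, Y0; split=> //.
have refl A : stable_retract A A by apply/stable_retract_iso/isomorphic_refl.
apply/stable_retract_summand/(stable_retract_trans (B := X)).
  exact: stable_retract_presyzygy (refl M) (syzygy_presyzygy MX0) MX.
apply: stable_retract_trans XY _.
exact: stable_retract_presyzygy (refl N) NY (syzygy_presyzygy NY0).
Qed.

Lemma ele_trans_fin x m n :
  (x <= Fin m)%enat -> (m <= n)%N -> (x <= Fin n)%enat.
Proof. by case: x => //= l; apply: leq_trans. Qed.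

Lemma resolvable_resolution a k M : resolvable a k M ->
  exists (C : nat -> fgmod R) (d : forall i, {linear C i.+1 -> C i})
      (e : {linear C 0%N -> M}) (m : nat),
    exact_resolution a d e /\
    forall i, (i <= a)%N -> (dell (i + k) (C i) <= Fin m)%enat.
Proof.
elim: a k M => [|a IHa] k M.
  move=> /dell_finite[b dell_b].
  exists (fun i => if i is _.+1 then free_fgmod R 0 else M).
  exists (fun i => \0), idfun, b; split; last by case.
  split=> // [x | x | x]; [by exists x | | exact: free_fgmod0].
  by split=> [x0 | [y <-]] //; exists 0; apply: esym x0.
move=> [K [X [i0 [e0 [[inj_i0 ex_0 surj_e0] /dell_finite[b dell_b]]]]]].
move=> /IHa[C [d [e [m [[surj_e ex_e ex_d C0] dell_m]]]]].
pose C' i := if i is i'.+1 then C i' else X.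
pose d' : forall i, {linear C' i.+1 -> C' i} := fun i =>
  match i return {linear C' i.+1 -> C' i} with
  | i'.+1 => d i'
  | 0%N => i0 \o e
  end.
exists C', d', e0, (maxn b m); split.
  split=> //.
    move=> y; rewrite ex_0; split=> [[x <-] | [x <-]]; last by exists (e x).
    by have [w <-] := surj_e x; exists w.
  case=> [_ | i lt_ia] /=; last exact: ex_d.
  move=> y; rewrite -ex_e /=; split=> [ie0 | ->]; last by rewrite linear0.
  by apply: inj_i0; rewrite linear0.
case=> [_ | i le_ia]; first exact: ele_trans_fin dell_b (leq_maxl _ _).
by rewrite addSnnS; apply: ele_trans_fin (dell_m i le_ia) (leq_maxr _ _).
Qed.

Lemma ddell_finite a k M :
  resolvable a k M -> exists b, (ddell k M <= Fin b)%enat.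
Proof.
move=> /resolvable_resolution[C [d [e [m [res dell_m]]]]].
exists (a + m)%N; apply/einf_leP; exists (a + m)%N => //.
exists a; first exact: leq_addr.
exists C, d, e; split=> // i le_ia; apply: ele_trans_fin (dell_m i le_ia) _.
by rewrite addnC -addnBA // leq_addr.
Qed.

Lemma ddell_isomorphic k M N b : isomorphic M N ->
  (ddell k M <= Fin b)%enat -> (ddell k N <= Fin b)%enat.
Proof.
move=> [f [g fK gK]] /einf_leP[m le_mb [n le_nm [C [d [e [res dellC]]]]]].
apply/einf_leP; exists m => //; exists n => //.
exists C, d, (f \o e); split=> //.
have [surj_e ex_e ex_d C0] := res; split=> //.
  by move=> y; have [x ex] := surj_e (g y); exists x; rewrite /= ex gK.
move=> y; rewrite -ex_e /=; split=> [fe0 | ->]; last by rewrite linear0.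
by rewrite -[LHS]fK fe0 -(linear0 f) fK.
Qed.

End Stable.

(** * Local rings *)

Section Local.
Variable R : pzRingType.

Lemma submod_closed0 (M : lmodType R) : submod_closed (pred1 (0 : M)).
Proof.
split=> [|a x y]; rewrite !inE // => /eqP-> /eqP->.
by rewrite scaler0 addr0.
Qed.

Lemma submod_sum_cyclic (M : lmodType R) (N : {pred M}) (y : M) :
  submod_closed N -> submod_closed [pred z | `[< exists r, z - r *: y \in N >]].
Proof.
move=> [N0 ND]; split=> [|a z w /asboolP[r Nz] /asboolP[s Nw]]; apply/asboolP.
  by exists 0; rewrite scale0r subr0.
exists (a * r + s); rewrite scalerDl opprD addrACA -scalerA -scalerBr.
exact: ND.
Qed.

Lemma maximal_submodule_cyclic (M : lmodType R) (N : {pred M}) (y : M) :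
  maximal_submodule N -> y \notin N -> forall z, exists r, z - r *: y \in N.
Proof.
move=> [closedN _ maxN] Ny z; have [N0 ND] := closedN.
have [|eqN | allN] := maxN _ (submod_sum_cyclic y closedN).
- by move=> w Nw; apply/asboolP; exists 0; rewrite scale0r subr0.
- case/negP: Ny; rewrite -eqN; apply/asboolP.
  by exists 1; rewrite scale1r subrr.
exact/asboolP/allN.
Qed.

Lemma colon_submod (M : lmodType R) (N : {pred M}) (x : M) :
  submod_closed N -> submod_closed [pred r : R^o | (r : R) *: x \in N].
Proof.
move=> [N0 ND]; split=> [|a r s]; rewrite !inE ?scale0r // => Nr Ns.
by rewrite scalerDl -scalerA ND.
Qed.

Lemma colon_maximal (M : lmodType R) (N : {pred M}) (x : M) :
  submod_closed N -> x \notin N ->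
  (forall y, y *: x \notin N -> exists r, x - r *: (y *: x) \in N) ->
  maximal_submodule [pred r : R^o | (r : R) *: x \in N].
Proof.
move=> closedN Nx cyc_x; split; [exact: colon_submod | |].
  by exists 1; rewrite inE scale1r.
move=> Y [Y0 YD] subY.
have [[y [Yy Ny]] | noy] :=
  pselect (exists y : R, y \in Y /\ y *: x \notin N); last first.
  left=> r; apply/idP/idP => [Yr | /subY//].
  rewrite inE; apply/negPn/negP => Nr.
  by apply: noy; exists r.
right=> r; have [s Ns] := cyc_x y Ny.
have Y1 : (1 : R^o) \in Y.
  rewrite -[1](subrK (s * y : R^o)) addrC; apply: YD => //; apply: subY.
  by rewrite inE scalerBl scale1r -scalerA.
by rewrite -[r]addr0 -[r]mulr1; apply: YD.
Qed.

Lemma linear_of_colon (M M' : lmodType R) (N : {pred M}) (x : M) (u : M') :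
  submod_closed N -> (forall z, exists r, z - r *: x \in N) ->
  (forall r, r *: x \in N -> r *: u = 0) ->
  exists f : {linear M -> M'}, f x = u.
Proof.
move=> [N0 ND] cyc_x ann_u.
have fun_u z r s : z - r *: x \in N -> z - s *: x \in N -> r *: u = s *: u.
  move=> Nr Ns; apply/eqP; rewrite -subr_eq0 -scalerBl; apply/eqP/ann_u.
  by have := ND (-1) _ _ Nr Ns; rewrite scaleN1r opprB addrA subrK scalerBl.
have [f fE] : exists f : {linear M -> M'},
    forall z, exists2 r, z - r *: x \in N & f z = r *: u.
  apply: (linear_of_rel
    (G := fun z w => exists2 r, z - r *: x \in N & w = r *: u)).
  - by move=> z; have [r Nr] := cyc_x z; exists (r *: u), r.
  - by move=> z w w' [r Nr ->] [s Ns ->]; apply: fun_u Nr Ns.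
  - move=> a z w z' w' [r Nr ->] [s Ns ->]; exists (a * r + s).
      by rewrite scalerDl opprD addrACA -scalerA -scalerBr ND.
    by rewrite scalerDl scalerA.
exists f; have [r Nr ->] := fE x; rewrite -[RHS]scale1r.
by apply: fun_u Nr _; rewrite scale1r subrr.
Qed.

Definition local_ring : Prop :=
  exists2 I : {pred R^o}, maximal_submodule I &
    forall J : {pred R^o}, maximal_submodule J -> J =i I.

Variable locR : local_ring.

Lemma local_ring_oner_neq0 : (1 : R) != 0.
Proof.
have [I [[I0 ID] [x Ix] _] _] := locR; apply: contra Ix => /eqP R0.
by rewrite -[x]mulr1 R0 mulr0.
Qed.

Lemma simple_isomorphic (S T : lmodType R) :
  simple_module S -> simple_module T -> isomorphic S T.
Proof.
have simple_max (U : lmodType R) :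
    simple_module U -> maximal_submodule (pred1 (0 : U)).
  move=> [[x x0] simU]; split; [exact: submod_closed0 | by exists x |].
  move=> Y closedY _; have [Y0 | Yall] := simU Y closedY; [left | by right].
  by move=> y; apply/idP/eqP => [/Y0 | ->] //; case: closedY.
have [I _ uniqI] := locR.
have hom (U V : lmodType R) (x : U) (y : V) :
    simple_module U -> simple_module V -> x != 0 -> y != 0 ->
    exists f : {linear U -> V}, f x = y.
  move=> /simple_max maxU /simple_max maxV x0 y0.
  have colon (W : lmodType R) (w : W) : maximal_submodule (pred1 (0 : W)) ->
      w != 0 -> [pred r : R^o | (r : R) *: w == 0] =i I.
    move=> maxW w0; apply/uniqI/(colon_maximal (N := pred1 0)) => //.
      exact: submod_closed0.
    by move=> s sw; apply: maximal_submodule_cyclic.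
  apply: (linear_of_colon (N := pred1 0)) => //.
  - exact: submod_closed0.
  - exact: maximal_submodule_cyclic.
  move=> r rx; apply/eqP; move: (colon _ y maxV y0 r).
  by rewrite -(colon _ x maxU x0) inE => ->.
move=> simS simT; have [[x x0] _] := simS; have [[y y0] _] := simT.
have [f fx] := hom _ _ _ _ simS simT x0 y0.
have [g gy] := hom _ _ _ _ simT simS y0 x0.
have cyc (U : lmodType R) (w z : U) :
    simple_module U -> w != 0 -> exists r, z = r *: w.
  move=> /simple_max maxU w0; have [r] := maximal_submodule_cyclic maxU w0 z.
  by rewrite inE subr_eq0 => /eqP; exists r.
exists f; exists g => z.
  by have [r ->] := cyc _ x z simS x0; rewrite !linearZ /= fx gy.
by have [r ->] := cyc _ y z simT y0; rewrite !linearZ /= gy fx.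
Qed.

Variable lenR : finite_length R.

Lemma maximal_submodule_exists (M : fgmod R) :
  (exists x : M, x != 0) -> exists N : {pred M}, maximal_submodule N.
Proof.
move=> [x0 nz_x0]; have [mu mu_rank] := lenR M.
have [|N [closedN properN] maxN] := exists_min (T := {pred M})
  (S := fun N => submod_closed N /\ exists x, x \notin N)
  (fun N => mu predT - mu N)%N.
  by exists (fun z : M => z == 0); split; [exact: submod_closed0 | exists x0].
exists N; split=> // Y closedY subNY.
have [[y Yy] | allY] := pselect (exists y, y \notin Y); last first.
  by right=> y; apply/negPn/negP => Yy; apply: allY; exists y.
left=> z; apply/idP/idP; last exact: subNY.
have closedT : submod_closed (@predT M) by [].
have [_ sub] := mu_rank _ _ closedN closedY subNY.
have [leT _] := mu_rank _ _ closedY closedT (fun _ _ => isT).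
move: z; apply: sub; have le_min : (mu predT - mu N <= mu predT - mu Y)%N.
  by apply: maxN; split=> //; exists y.
have arith a b t : (b <= t -> t - a <= t - b -> b <= a)%N by lia.
exact: arith leT le_min.
Qed.

Lemma simple_generator_exists (M : fgmod R) : (exists x : M, x != 0) ->
  exists2 u : M, u != 0 & forall y, y *: u != 0 -> exists r, u = r *: (y *: u).
Proof.
move=> nzM; have [mu mu_rank] := lenR M.
pose cyc (u : M) := im_pred (fun r : R => r *: u).
have closed_cyc u : submod_closed (cyc u).
  split=> [|a _ _ /im_predP[r <-] /im_predP[s <-]]; apply/im_predP.
    by exists 0; rewrite scale0r.
  by exists (a * r + s); rewrite scalerDl scalerA.
have [u nz_u min_u] := exists_min (fun u => mu (cyc u)) nzM.
exists u => // y nz_yu.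
have sub : {subset cyc (y *: u) <= cyc u}.
  by move=> _ /im_predP[r <-]; apply/im_predP; exists (r * y); rewrite scalerA.
have [_ /(_ (min_u _ nz_yu)) sub'] :=
  mu_rank _ _ (closed_cyc _) (closed_cyc _) sub.
have /sub'/im_predP[r eu] : u \in cyc u.
  by apply/im_predP; exists 1; rewrite scale1r.
by exists r; rewrite eu.
Qed.

Lemma hom_to_ring_exists (M : fgmod R) : (exists x : M, x != 0) ->
  exists (f : {linear M -> free_fgmod R 1}) (x : M), f x != 0.
Proof.
move=> nzM; have [I _ uniqI] := locR.
have [u nz_u cyc_u] : exists2 u : free_fgmod R 1, u != 0 &
    forall y, y *: u != 0 -> exists r, u = r *: (y *: u).
  apply: simple_generator_exists; exists (\row__ 1).
  apply/eqP => /rowP/(_ 0); rewrite !mxE => /eqP.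
  by apply/negP/local_ring_oner_neq0.
have [N maxN] := maximal_submodule_exists nzM.
have [closedN [x Nx] _] := maxN.
have colonN : [pred r : R^o | (r : R) *: x \in N] =i I.
  by apply/uniqI/colon_maximal => // y Ny; apply: maximal_submodule_cyclic.
have ann_u : [pred r : R^o | (r : R) *: u \in pred1 0] =i I.
  apply/uniqI/colon_maximal => //; first exact: submod_closed0.
  by move=> y /cyc_u[r eu]; exists r; rewrite -eu subrr inE.
have [|f fx] :=
  linear_of_colon (u := u) closedN (maximal_submodule_cyclic maxN Nx).
  by move=> r rx; apply/eqP; move: (ann_u r); rewrite -colonN !inE rx.
by exists f, x; rewrite fx.
Qed.

End Local.

(** * Modules over a finite dimensional algebra *)

Section FiniteDimensional.
Variables (K : fieldType) (L : falgType K).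

Lemma vspace_of_pred (V : vectType K) (S : V -> Prop) :
  S 0 -> (forall a u v, S u -> S v -> S (a *: u + v)) ->
  exists U : {vspace V}, forall v, v \in U <-> S v.
Proof.
move=> S0 SD.
have [|U US minU] := exists_min (T := {vspace V})
  (S := fun U => forall v, v \in U -> S v) (fun U => \dim {:V} - \dim U)%N.
  by exists 0%VS => v; rewrite memv0 => /eqP->.
exists U => v; split=> [/US // | Sv].
have sub_sum : (U <= U + <[v]>)%VS by apply: addvSl.
have le_dim : (\dim {:V} - \dim U <= \dim {:V} - \dim (U + <[v]>)%VS)%N.
  apply: minU => _ /memv_addP[w Uw [_ /vlineP[a ->] ->]].
  by rewrite addrC; apply: SD => //; apply: US.
have le_full : (\dim (U + <[v]>)%VS <= \dim {:V})%N by apply/dimvS/subvf.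
have arith a b t : (b <= t -> t - a <= t - b -> b <= a)%N by lia.
have : U == (U + <[v]>)%VS.
  by rewrite eqEdim sub_sum (arith _ _ _ le_full le_dim).
by move/eqP->; apply: (subvP (addvSr _ _)); apply: memv_line.
Qed.

Lemma scalar_cover (M : lmodType L^c) : finitely_generated M ->
  exists (V : vectType K) (f : V -> M), surj f /\
    forall a u v, f (a *: u + v) = (a%:A : L^c) *: f u + f v.
Proof.
move=> [n [g gen_g]]; exists {ffun 'I_n -> L}.
exists (fun v : {ffun 'I_n -> L} => \sum_i (v i : L^c) *: g i).
split=> [y | a u v].
  have [c ->] := gen_g y; exists [ffun i => c i : L].
  by apply: eq_bigr => i _; rewrite ffunE.
rewrite scaler_sumr -big_split /=; apply: eq_bigr => i _.
rewrite !ffunE scalerA -scalerDl; congr (_ *: _); congr (_ + _).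
by rewrite -[LHS]mulr_algr.
Qed.

Lemma semilinear0 (V : lmodType K) (M : lmodType L^c) (f : V -> M) :
  (forall a u v, f (a *: u + v) = (a%:A : L^c) *: f u + f v) -> f 0 = 0.
Proof.
move=> lin_f; have := lin_f 1 0 0; rewrite scaler0 addr0.
rewrite [in RHS](scale1r (1 : L)).
rewrite [X in _ = X + _](scale1r (f 0)) => /eqP.
by rewrite -subr_eq subrr eq_sym => /eqP.
Qed.

Lemma pullback_vspace (M : lmodType L^c) (V : vectType K)
    (f : V -> M) (X : {pred M}) :
  (forall a u v, f (a *: u + v) = (a%:A : L^c) *: f u + f v) ->
  submod_closed X ->
  exists U : {vspace V}, forall v, v \in U <-> f v \in X.
Proof.
move=> lin_f [X0 XD]; apply: vspace_of_pred => [|a u v Xu Xv].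
  by rewrite (semilinear0 lin_f).
by rewrite lin_f XD.
Qed.

Lemma noetherian_falg : noetherian L^c.
Proof.
move=> M X hX; have [V [f [surj_f lin_f]]] := scalar_cover (fgmodP M).
have [U UE] := pullback_vspace lin_f hX.
have [i [inj_i iE]] := submodule_incl hX.
have /choice[g gE] : forall j : 'I_(\dim U), exists x, i x = f (vbasis U)`_j.
  by move=> j; apply/iE/UE/vbasis_mem/mem_nth; rewrite size_tuple.
exists (\dim U), g => x; have [v fv] := surj_f (i x).
have Uv : v \in U by apply/UE; rewrite fv; apply/iE; exists x.
exists (fun j => (coord (vbasis U) j v)%:A : L^c); apply: inj_i.
rewrite linear_sum -fv {1}(coord_vbasis Uv).
elim/big_rec2: _ => [|j w u _ eqw]; first exact: semilinear0.
by rewrite lin_f -eqw linearZ /= gE.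
Qed.

Lemma finite_length_falg : finite_length L^c.
Proof.
move=> M; have [V [f [surj_f lin_f]]] := scalar_cover (fgmodP M).
have /choice[U UE] : forall X : {pred M}, exists U : {vspace V},
    submod_closed X -> forall v, v \in U <-> f v \in X.
  move=> X; have [/(pullback_vspace lin_f)[U UE] | nX] :=
    pselect (submod_closed X).
    by exists U.
  by exists 0%VS.
exists (fun X => \dim (U X)) => X Y hX hY subXY.
have subU : (U X <= U Y)%VS.
  by apply/subvP => v /(UE _ hX) Xv; apply/(UE _ hY)/subXY.
split=> [|le_dim y Yy]; first exact: dimvS.
have eqU : U X = U Y by apply/eqP; rewrite eqEdim subU.
have [v fv] := surj_f y; rewrite -fv -(UE _ hX) eqU.
by apply/(UE _ hY); rewrite fv.
Qed.

End FiniteDimensional.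

Theorem theorem3p3 (K : fieldType) (L : falgType K) (k : nat) :
  local_algebra L -> (1 <= k)%N -> (ddell_algebra L k < Infty)%enat.
Proof.
move=> locL _; have lenL := @finite_length_falg K L.
have noethL := @noetherian_falg K L.
apply/einf_ltInfty.
have [[S simS] | noS] :=
  pselect (exists S : fgmod L^c, simple_module S); last first.
  by exists 0%N => x [S [simS _]]; case: noS; exists S.
have [a resS] := all_resolvable noethL lenL (hom_to_ring_exists locL lenL) k S.
have [b ddellS] := ddell_finite noethL lenL resS.
exists b => _ [T [simT ->]]; apply: ddell_isomorphic ddellS.
exact: simple_isomorphic.
Qed.
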